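(* There exists a positive integer $q'$ such that for each integer $q\ge q'$, any graph that is cospectral with the Hamming graph $H(3,q)$ is the intersection graph of some linear $3$-uniform hypergraph.
   Context: All graphs are finite, undirected and simple. Two graphs are cospectral if their adjacency matrices have the same spectrum (as multisets of eigenvalues). For a set $X$ of size $q\geq 2$, the Hamming graph $H(3,q)$ has vertex set $X^3$, two vertices being adjacent iff they differ in precisely one coordinate. A hypergraph $H$ is a pair $(X,E)$ with $X$ a finite set (vertices) and $E$ a set of non-empty subsets of $X$ (edges). It is $h$-uniform ($h\ge 2$) if every edge has cardinality $h$; it is linear if every pair of distinct vertices is contained in at most one edge. The intersection graph of $H=(X,E)$ is the graph with vertex set $E$ in which two distinct edges $e,e'\in E$ are adjacent iff $e\cap e'\ne\emptyset$. Graphs are identified up to isomorphism. *)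

(* Defs.v *)
From HB Require Import structures.
From mathcomp Require Import all_boot all_order all_algebra all_field.

Set Implicit Arguments.
Unset Strict Implicit.
Unset Printing Implicit Defensive.

Import GRing.Theory.
Local Open Scope ring_scope.

Record sgraph := SGraph {
  vertex :> finType;
  adj : rel vertex;
  adj_sym : symmetric adj;
  adj_irr : irreflexive adj
}.

Definition graph_iso (G H : sgraph) : Prop :=
  exists2 f : G -> H, bijective f & forall x y, adj (f x) (f y) = adj x y.

Definition adjacency_mx (G : sgraph) : 'M[algC]_#|G| :=
  \matrix_(i, j) (adj (enum_val i) (enum_val j))%:R.

(* The eigenvalues with their multiplicities, in an arbitrary order: sequences
   chosen here are meant to be compared with [perm_eq]. *)
Definition spectrum n (A : 'M[algC]_n) : seq algC :=
  sval (closed_field_poly_normal (char_poly A)).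

Lemma spectrumP n (A : 'M[algC]_n) :
  char_poly A = \prod_(a <- spectrum A) ('X - a%:P).
Proof.
rewrite /spectrum; case: closed_field_poly_normal => s /= {1}->.
by rewrite (monicP (char_poly_monic A)) scale1r.
Qed.

Lemma mem_spectrum n (A : 'M[algC]_n) a : (a \in spectrum A) = eigenvalue A a.
Proof. by rewrite eigenvalue_root_char spectrumP root_prod_XsubC. Qed.

Definition cospectral (G H : sgraph) : bool :=
  perm_eq (spectrum (adjacency_mx G)) (spectrum (adjacency_mx H)).

Section Hamming.
Variables (d : nat) (X : finType).

Definition hamming_adj : rel {ffun 'I_d -> X} :=
  fun u v => #|[set i | u i != v i]| == 1%N.

Fact hamming_adj_sym : symmetric hamming_adj.
Proof.
move=> u v; rewrite /hamming_adj.
by under eq_finset => i do rewrite eq_sym.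
Qed.

Fact hamming_adj_irr : irreflexive hamming_adj.
Proof.
move=> u; rewrite /hamming_adj.
by under eq_finset => i do rewrite eqxx; rewrite cards0.
Qed.

Definition hamming : sgraph := SGraph hamming_adj_sym hamming_adj_irr.

End Hamming.

Record hypergraph := Hypergraph {
  hvertex : finType;
  hedges : {set {set hvertex}};
  hedges_neq0 : set0 \notin hedges
}.

Definition uniform_hypergraph (h : nat) (H : hypergraph) : Prop :=
  forall e, e \in hedges H -> #|e| = h.

Definition linear_hypergraph (H : hypergraph) : Prop :=
  forall x y : hvertex H, x != y ->
  forall e e', e \in hedges H -> e' \in hedges H ->
    x \in e -> y \in e -> x \in e' -> y \in e' -> e = e'.

Section IntersectionGraph.
Variable H : hypergraph.

Definition inter_adj : rel {e : {set hvertex H} | e \in hedges H} :=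
  fun e e' => (e != e') && (val e :&: val e' != set0).

Fact inter_adj_sym : symmetric inter_adj.
Proof. by move=> e e'; rewrite /inter_adj eq_sym setIC. Qed.

Fact inter_adj_irr : irreflexive inter_adj.
Proof. by move=> e; rewrite /inter_adj eqxx. Qed.

Definition intersection_graph : sgraph := SGraph inter_adj_sym inter_adj_irr.

End IntersectionGraph.

(* Main.v *)
(** Write A for the adjacency matrix of a graph G cospectral with H(3,q), and put
    M = A + 3.  The eigenvalues of M are 0, q, 2q, 3q, since for H(3,q) it is the
    sum of the three commuting "sum along a coordinate" operators B, which satisfy
    B^2 = q B.  Comparing tr A^2 with the largest eigenvalue shows that G is regular
    of valency 3q - 3, and then M^2 - q M is positive semidefinite with diagonal
    entries 6.  So all its entries are at most 6 in absolute value: adjacent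
    vertices have between q - 12 and q common neighbours, nonadjacent ones at most
    6.  For q >= 100 this leaves no room for four pairwise nonadjacent neighbours
    of a vertex x, so the neighbourhood of x splits into three cliques
    of size about q: two neighbours y, z of x are in the same one iff x, y, z have
    at least 40 common neighbours.  This condition being symmetric in x, y, z, the
    sets of all z satisfying it for an edge xy form a system of lines, three through
    each vertex, two of which meet at most once.  The hypergraph has these lines as
    vertices, and each vertex of G as the edge made of the three lines through it. *)
From HB Require Import structures.
Require Import Defs.
From mathcomp Require Import all_boot all_order all_algebra all_field.
From mathcomp Require Import ring zify.

Set Implicit Arguments.
Unset Strict Implicit.
Unset Printing Implicit Defensive.

Import Order.TTheory GRing.Theory Num.Theory.
Local Open Scope ring_scope.
Local Open Scope sesquilinear_scope.

(** * Quadratic polynomials in a normal matrix *)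

Definition quadmx n (a b c : algC) (A : 'M[algC]_n) : 'M[algC]_n :=
  a *: (A *m A) + b *: A + c%:M.

Lemma quadmx_entry n a b c (A : 'M[algC]_n) i j :
  quadmx a b c A i j = a * (A *m A) i j + b * A i j + c *+ (i == j).
Proof. by rewrite 2!mxE [(a *: (A *m A)) i j]mxE [(b *: A) i j]mxE [c%:M i j]mxE. Qed.

(** Taken at [e = 1] and [e = -1], this bounds an off-diagonal entry of a positive semidefinite
    matrix by the diagonal ones. *)
Lemma form_delta_mx2 n (Q : 'M[algC]_n) i j (e : algC) : e \is Num.real ->
  let v : 'rV_n := delta_mx 0 i + e *: delta_mx 0 j in
  (v *m Q *m v^t*) 0 0 = Q i i + e * (Q i j + Q j i) + e ^+ 2 * Q j j.
Proof.
move=> e_real v; have -> : v^t* = delta_mx i 0 + e *: delta_mx j 0.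
  apply/matrixP => k l; rewrite !mxE rmorphD rmorphM /= !conjC_nat.
  by rewrite (CrealP e_real) ![(l == 0) && _]andbC.
rewrite mulmxDl -scalemxAl -!rowE !mulmxDr -!scalemxAr -!colE !mxE; ring.
Qed.

Section NormalMatrix.

Variables (n : nat) (A : 'M[algC]_n).
Hypothesis normalA : A \is normalmx.

Let P := spectralmx A.
Let d := spectral_diag A.

Let PtP : P^t* *m P = 1%:M.
Proof. by rewrite -invmx_unitary ?spectral_unitarymx// mulVmx ?spectral_unit. Qed.

Let PPt : P *m P^t* = 1%:M.
Proof. exact/unitarymxP/spectral_unitarymx. Qed.

Let AE : A = P^t* *m diag_mx d *m P.
Proof.
by rewrite -[P^t*]invmx_unitary ?spectral_unitarymx//; exact/orthomx_spectralP.
Qed.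

(** The roots of the characteristic polynomial agree with the unitary diagonalization because the
    characteristic matrices of [A] and of [diag_mx d] are conjugate by [P]. *)
Lemma perm_spectrum_diag :
  perm_eq (spectrum A) [seq spectral_diag A 0 i | i <- enum 'I_n].
Proof.
apply: prod_XsubC_eq; rewrite -spectrumP big_map big_enum /=.
have -> : \prod_(i < n) ('X - (d 0 i)%:P) = char_poly (diag_mx d).
  rewrite char_poly_trig ?diag_mx_is_trig//.
  by apply: eq_bigr => i _; rewrite mxE eqxx.
have PtP' := congr1 (map_mx (@polyC algC)) PtP.
rewrite map_mxM map_mx1 in PtP'.
have XE : char_poly_mx A =
    map_mx (@polyC algC) (P^t*) *m char_poly_mx (diag_mx d)
      *m map_mx (@polyC algC) P.
  rewrite /char_poly_mx mulmxBr mulmxBl mul_mx_scalar -scalemxAl PtP'.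
  by rewrite -map_mxM -map_mxM -AE scalemx1.
rewrite /char_poly XE !det_mulmx mulrC mulrA -det_mulmx.
by rewrite -map_mxM PPt map_mx1 det1 mul1r.
Qed.

Lemma mem_spectral_diag i : d 0 i \in spectrum A.
Proof. by rewrite (perm_mem perm_spectrum_diag) map_f ?mem_enum. Qed.

Lemma quadmxE a b c : quadmx a b c A =
  P^t* *m diag_mx (\row_i (a * d 0 i ^+ 2 + b * d 0 i + c)) *m P.
Proof.
have -> : diag_mx (\row_i (a * d 0 i ^+ 2 + b * d 0 i + c)) =
    a *: (diag_mx d *m diag_mx d) + b *: diag_mx d + c%:M.
  rewrite mulmx_diag; apply/matrixP => i j; rewrite !mxE.
  by case: eqP => _; rewrite ?mulr1n ?mulr0n ?mulr0 ?addr0// expr2.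
rewrite 2!mulmxDr 2!mulmxDl -!scalemxAr -!scalemxAl mul_mx_scalar -scalemxAl PtP.
rewrite scalemx1 -AE; congr (_ *: _ + _ + _).
rewrite {1 2}AE !mulmxA; congr (_ *m _ *m _).
by rewrite -!mulmxA PPt mulmx1.
Qed.

Lemma trace_sqr_spectrum : \tr (A *m A) = \sum_(t <- spectrum A) t ^+ 2.
Proof.
have := quadmxE 1 0 0.
rewrite /quadmx scale1r scale0r addr0 raddf0 addr0 => ->.
rewrite -mulmxA mxtrace_mulC -mulmxA PPt mulmx1 mxtrace_diag.
rewrite (perm_big _ perm_spectrum_diag) big_map big_enum /=.
by apply: eq_bigr => i _; rewrite mxE mul1r mul0r !addr0.
Qed.

Section NonnegQuadratic.

Variables a b c : algC.
Hypothesis quad_ge0 : {in spectrum A, forall t, 0 <= a * t ^+ 2 + b * t + c}.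

Let quad_form (v : 'rV_n) : (v *m quadmx a b c A *m v^t*) 0 0 =
  \sum_i (a * d 0 i ^+ 2 + b * d 0 i + c) * `|(v *m P^t*) 0 i| ^+ 2.
Proof.
rewrite quadmxE !mulmxA -mulmxA; set w := v *m P^t*.
have -> : P *m v^t* = w^t*.
  by rewrite /w trmx_mul map_mxM trmxCK.
rewrite mxE; apply: eq_bigr => i _.
rewrite mul_mx_diag !mxE normCK; ring.
Qed.

(** In the eigenbasis the form is a sum of squared moduli, weighted by the values of the polynomial
    at the eigenvalues. *)
Lemma quadmx_psd (v : 'rV_n) : 0 <= (v *m quadmx a b c A *m v^t*) 0 0.
Proof.
rewrite quad_form sumr_ge0 // => i _.
by rewrite mulr_ge0 ?exprn_ge0// quad_ge0// mem_spectral_diag.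
Qed.

(** Every term of that sum vanishes, so each coordinate of [v] in the eigenbasis is zero or has
    weight zero. *)
Lemma quadmx_psd_eq0 (v : 'rV_n) :
  (v *m quadmx a b c A *m v^t*) 0 0 = 0 -> v *m quadmx a b c A = 0.
Proof.
rewrite quad_form => /eqP; rewrite psumr_eq0 => [/allP form0|i _]; last first.
  by rewrite mulr_ge0 ?exprn_ge0// quad_ge0// mem_spectral_diag.
rewrite quadmxE !mulmxA.
suff -> : v *m P^t* *m diag_mx (\row_i (a * d 0 i ^+ 2 + b * d 0 i + c)) = 0.
  by rewrite mul0mx.
apply/rowP => i; rewrite mul_mx_diag [in RHS]mxE [in LHS]mxE [_ (\row__ _) _ _]mxE.
have := form0 i (mem_index_enum _).
rewrite mulf_eq0 expf_eq0 normr_eq0 /= => /orP[] /eqP ->.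
  by rewrite mulr0.
by rewrite mul0r.
Qed.

Lemma quadmx_entry_bound s t i j :
    quadmx a b c A i i = s -> quadmx a b c A j j = s ->
    quadmx a b c A i j = t -> quadmx a b c A j i = t ->
  (0 <= s + t) && (0 <= s - t).
Proof.
move=> ii jj ij ji.
have psd (e : algC) := quadmx_psd (delta_mx 0 i + e *: delta_mx 0 j).
apply/andP; split.
  have := psd 1; rewrite form_delta_mx2 ?rpred1// ii jj ij ji.
  have -> : s + 1 * (t + t) + 1 ^+ 2 * s = (s + t) *+ 2 by ring.
  by rewrite pmulrn_lge0.
have := psd (-1); rewrite form_delta_mx2 ?rpredN ?rpred1// ii jj ij ji.
have -> : s + -1 * (t + t) + (-1) ^+ 2 * s = (s - t) *+ 2 by ring.
by rewrite pmulrn_lge0.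
Qed.

End NonnegQuadratic.
End NormalMatrix.

(** * The spectrum of the Hamming graph *)

(** Each [T i] has no eigenvalues but 0 and [q], and by commutation [f] can be replaced by a common
    eigenvector inside the [t]-eigenspace of the sum. *)
Lemma commuting_quasi_idempotents_eigenvalue (F : fieldType) (V : lmodType F)
    (d : nat) (T : 'I_d -> {linear V -> V}) (q t : F) (f : V) :
    (forall i j g, T i (T j g) = T j (T i g)) ->
    (forall i g, T i (T i g) = q *: T i g) ->
    f != 0 -> \sum_i T i f = t *: f ->
  exists2 m : nat, (m <= d)%N & t = q *+ m.
Proof.
move=> TC TT f0 fE.
have [g [g0 gE [c gT]]] : exists g, [/\ g != 0, \sum_i T i g = t *: g &
    exists c : 'I_d -> bool, {in enum 'I_d, forall i, T i g = (q *+ c i) *: g}].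
  (* Replacing [g] by [T i g], unless the latter vanishes, makes it an eigenvector
     of [T i]. *)
  elim: (enum _) => [|i s [g [g0 gE [c gT]]]].
    by exists f; split=> //; exists xpred0.
  have [Tg0|Tg0] := eqVneq (T i g) 0.
    exists g; split=> //; exists (fun j => if j == i then false else c j) => j.
    rewrite inE; case: eqP => [-> _|_ /gT//].
    by rewrite Tg0 mulr0n scale0r.
  exists (T i g); split=> //.
    by rewrite -linearZ -gE linear_sum; apply: eq_bigr => j _; rewrite TC.
  exists (fun j => if j == i then true else c j) => j.
  rewrite inE; case: eqP => [-> _|_ /= /gT jE]; first by rewrite TT.
  by rewrite TC jE linearZ.
(* The number of operators to which the eigenvalue [q] was assigned. *)
exists (\sum_i c i)%N.
  by rewrite -[leqRHS]card_ord -sum1_card leq_sum// => i _; case: (c i).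
apply/eqP; rewrite -subr_eq0; apply: contraTT g0 => tE; rewrite negbK.
rewrite -(can_eq (scalerK tE)) scaler0 scalerBl -gE -sumrMnr scaler_suml.
by under eq_bigr do rewrite gT ?mem_enum//; rewrite subrr.
Qed.

Section HammingEigenvalues.

Variables (d : nat) (X : finType).
Notation V := {ffun 'I_d -> X}.

Definition update (u : V) (i : 'I_d) (x : X) : V :=
  [ffun j => if j == i then x else u j].

(** As a tensor product: the all-one matrix in factor [i], the identity in the others. The point [u]
    itself is included in the sum. *)
Definition line_sum (i : 'I_d) (f : {ffun V -> algC^o}) : {ffun V -> algC^o} :=
  [ffun u => \sum_x f (update u i x)].

Fact line_sum_is_linear i : linear (line_sum i).
Proof.
move=> a f g; apply/ffunP => u; rewrite !ffunE scaler_sumr -big_split /=.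
by apply: eq_bigr => x _; rewrite !ffunE.
Qed.

HB.instance Definition _ i :=
  GRing.isLinear.Build algC {ffun V -> algC^o} {ffun V -> algC^o} _ (line_sum i)
    (line_sum_is_linear i).

Lemma line_sumC i j f : line_sum i (line_sum j f) = line_sum j (line_sum i f).
Proof.
have [->//|ij] := eqVneq i j; apply/ffunP => u; rewrite !ffunE.
under eq_bigr do rewrite ffunE; under [RHS]eq_bigr do rewrite ffunE.
rewrite exchange_big; apply: eq_bigr => x _; apply: eq_bigr => y _ /=.
congr (f _); apply/ffunP => l; rewrite !ffunE.
by case: eqP => [->|//]; rewrite eq_sym (negPf ij).
Qed.

Lemma line_sum_sum i f : line_sum i (line_sum i f) = #|X|%:R *: line_sum i f.
Proof.
apply/ffunP => u; rewrite !ffunE; under eq_bigr do rewrite ffunE.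
rewrite (eq_bigr (fun=> \sum_x f (update u i x))) => [|x _].
  by rewrite sumr_const scaler_nat.
apply: eq_bigr => y _; congr (f _); apply/ffunP => l; rewrite !ffunE.
by case: eqP.
Qed.

Lemma line_sumE i f u :
  line_sum i f u = \sum_(w : V | [set j | u j != w j] \subset [set i]) f w.
Proof.
rewrite ffunE (reindex_onto (update u i) (fun w : V => w i)) => [|w /subsetP uw].
  apply: eq_bigl => x; apply/esym/andP; split; last by rewrite ffunE eqxx.
  by apply/subsetP => j; rewrite !inE ffunE; have [//|_] := eqVneq j i; rewrite eqxx.
apply/ffunP => j; rewrite ffunE; case: eqP => [->//|/eqP/negPf ji].
by have := uw j; rewrite !inE ji; case: eqP => //= _ /(_ isT).
Qed.

(** Of the [d] lines through [u], all contain [u], exactly one contains a given neighbour and none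
    any other vertex; hence the line sums add up to A + d. *)
Lemma sum_line_sum f u :
  (\sum_i line_sum i f) u = f u *+ d + \sum_(w | hamming_adj u w) f w.
Proof.
rewrite sum_ffunE; under eq_bigr do rewrite line_sumE big_mkcond.
rewrite exchange_big (bigD1 u) //= [in RHS]big_mkcond [in RHS](bigD1 u) //=.
have diff_id : [set j | u j != u j] = set0.
  by apply/setP => j; rewrite !inE eqxx.
rewrite hamming_adj_irr add0r; congr (_ + _).
  under eq_bigr do rewrite diff_id sub0set.
  by rewrite sumr_const card_ord.
apply: eq_bigr => w wu; rewrite -big_mkcond sumr_const /hamming_adj.
set D := [set j | _]; have D0 : D != set0.
  apply: contraNneq wu => D0; apply/eqP/ffunP => j.
  by have /setP/(_ j) := D0; rewrite !inE => /negbFE/eqP.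
transitivity (f w *+ (#|D| == 1%N)); last by case: (_ == _).
have DP i : (D \subset [set i]) = (D == [set i]).
  by rewrite subset1 (negPf D0) orbF.
congr (_ *+ _); case: cards1P => [[j DE]|D1].
  by rewrite (eq_card1 (x := j))// => i;
    rewrite unfold_in DP DE inE (inj_eq set1_inj) eq_sym.
by rewrite eq_card0// => i; rewrite unfold_in DP; apply/eqP => DE; case: D1; exists i.
Qed.

Lemma hamming_degree (u : V) :
  (d + #|[set w : V | hamming_adj u w]| = d * #|X|)%N.
Proof.
apply/eqP; rewrite -(eqr_nat algC) natrD natrM; apply/eqP.
have := sum_line_sum [ffun=> 1] u.
rewrite sum_ffunE ffunE; under eq_bigr do rewrite ffunE.
under eq_bigr do under eq_bigr do rewrite ffunE.
rewrite !sumr_const card_ord; under eq_bigr do rewrite ffunE.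
by rewrite sumr_const -!mulrnA mulnC natrM cardsE => <-.
Qed.

Lemma hamming_spectrum t : t \in spectrum (adjacency_mx (hamming d X)) ->
  exists2 m : nat, (m <= d)%N & t = (#|X| * m)%:R - d%:R.
Proof.
rewrite mem_spectrum => /eigenvalueP[v vE v0].
pose f : {ffun V -> algC^o} := [ffun u => v 0 (enum_rank (u : hamming d X))].
have [| |m md tE] := commuting_quasi_idempotents_eigenvalue
    (T := line_sum) (q := #|X|%:R) (t := t + d%:R) (f := f) line_sumC line_sum_sum.
- apply: contraNneq v0 => /ffunP f0; apply/eqP/rowP => i.
  by have := f0 (enum_val i); rewrite !ffunE enum_valK mxE.
- apply/ffunP => u; rewrite sum_line_sum !ffunE scalerDl addrC scaler_nat.
  congr (_ + _); rewrite -[RHS]/(t * v 0 _).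
  have /rowP/(_ (enum_rank (u : hamming d X))) := vE; rewrite !mxE => <-.
  rewrite big_mkcond (reindex (fun i : 'I_#|hamming d X| => enum_val i)) /=; last first.
    by apply: onW_bij; exact: enum_val_bij.
  apply: eq_bigr => i _; rewrite ffunE mxE enum_valK enum_rankK.
  rewrite -[hamming_adj _ _]/(adj (u : hamming d X) _) adj_sym.
  by case: adj; rewrite ?mulr1 ?mulr0.
by exists m => //; rewrite natrM mulr_natr -tE addrK.
Qed.

End HammingEigenvalues.

(** * Valency and numbers of common neighbours *)

Definition nbhd (G : sgraph) (x : G) : {set G} := [set y | adj x y].

Section AdjacencyMatrix.

Variable G : sgraph.
Notation A := (adjacency_mx G).

Lemma adjacency_mx_normal : A \is normalmx.
Proof.
suff AE : A^t* = A by apply/normalmxP; rewrite AE.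
by apply/matrixP => i j; rewrite !mxE conjC_nat adj_sym.
Qed.

Lemma sum_enum_val (f : G -> algC) : \sum_(i < #|G|) f (enum_val i) = \sum_x f x.
Proof. by rewrite [RHS](reindex _ (onW_bij _ (@enum_val_bij G))). Qed.

Lemma adjacency_mx_sqr i j :
  (A *m A) i j = #|nbhd (enum_val i) :&: nbhd (enum_val j)|%:R.
Proof.
rewrite mxE; under eq_bigr do rewrite !mxE -natrM mulnb.
rewrite (sum_enum_val (fun x : G => (adj _ x && adj x _)%:R)) -natr_sum.
congr _%:R; rewrite -sum1_card [RHS]big_mkcond /=.
by apply: eq_bigr => x _; rewrite !inE (adj_sym x); case: andP.
Qed.

Lemma size_spectrum : size (spectrum A) = #|G|.
Proof.
rewrite (perm_size (perm_spectrum_diag adjacency_mx_normal)) size_map.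
by rewrite -cardE card_ord.
Qed.

Lemma sum_spectrum_sqr :
  \sum_(t <- spectrum A) t ^+ 2 = (\sum_(x : G) #|nbhd x|)%:R.
Proof.
rewrite -trace_sqr_spectrum ?adjacency_mx_normal// natr_sum -sum_enum_val.
by apply: eq_bigr => i _; rewrite adjacency_mx_sqr setIid.
Qed.

(* The all-one vector attains the Rayleigh bound [k], hence is an eigenvector. *)
Lemma spectrum_regular k :
    {in spectrum A, forall t, t <= k%:R} ->
    (\sum_(x : G) #|nbhd x| = #|G| * k)%N ->
  forall x : G, #|nbhd x| = k.
Proof.
move=> le_k sum_deg x.
pose v : 'rV[algC]_#|G| := const_mx 1.
have quadE : quadmx 0 (-1) k%:R A = k%:R%:M - A.
  by rewrite /quadmx scale0r add0r scaleN1r addrC.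
have vA i : (v *m quadmx 0 (-1) k%:R A) 0 i = k%:R - #|nbhd (enum_val i)|%:R.
  rewrite quadE mulmxBr mul_mx_scalar !mxE mulr1; congr (_ - _).
  under eq_bigr do rewrite !mxE mul1r.
  rewrite (sum_enum_val (fun x : G => (adj x _)%:R)) -natr_sum -sum1_card.
  congr _%:R; rewrite [RHS]big_mkcond /=.
  by apply: eq_bigr => y _; rewrite inE adj_sym; case: adj.
have vA0 : v *m quadmx 0 (-1) k%:R A = 0.
  apply: (quadmx_psd_eq0 adjacency_mx_normal) => [t /le_k|].
    by rewrite mul0r add0r mulN1r addrC subr_ge0.
  rewrite mxE; under eq_bigr do rewrite vA !mxE conjC1 mulr1.
  rewrite sumrB sumr_const card_ord -mulrnA (sum_enum_val (fun x : G => #|nbhd x|%:R)).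
  by rewrite -natr_sum sum_deg mulnC subrr.
have /rowP/(_ (enum_rank x)) := vA0; rewrite vA enum_rankK mxE => /eqP.
by rewrite subr_eq0 eqr_nat => /eqP.
Qed.

End AdjacencyMatrix.

(** * Parameters of a graph cospectral with H(3,q) *)

Section HammingCospectral.

Variables (q : nat) (G : sgraph).
Hypothesis cosp : cospectral G (hamming 3 'I_q).
Hypothesis q_gt0 : (0 < q)%N.

Lemma cospectral_hamming_spectrum t : t \in spectrum (adjacency_mx G) ->
  exists2 m : nat, (m <= 3)%N & t = (q * m)%:R - 3.
Proof. by rewrite (perm_mem cosp) => /hamming_spectrum; rewrite card_ord. Qed.

Lemma cospectral_hamming_regular (x : G) : (#|nbhd x| + 3 = 3 * q)%N.
Proof.
rewrite (@spectrum_regular G (3 * q - 3)) => [|t /cospectral_hamming_spectrum|].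
- by rewrite subnK// leq_pmulr.
- move=> [m m3 ->]; rewrite natrB ?leq_pmulr// lerB// ler_nat mulnC leq_mul2r m3 orbT.
- by [].
(* The sum of the valencies is tr A^2, which is determined by the spectrum, as is the number of
   vertices. *)
apply/eqP; rewrite -(eqr_nat algC) -sum_spectrum_sqr (perm_big _ cosp).
rewrite sum_spectrum_sqr eqr_nat -(size_spectrum G) (perm_size cosp) size_spectrum.
rewrite (eq_bigr (fun=> 3 * q - 3)%N) ?sum_nat_const// => u _.
by have := hamming_degree u; rewrite card_ord => <-; rewrite addKn.
Qed.

(** The matrix (A + 3)(A + 3 - q) is positive semidefinite with diagonal 6. For c common neighbours
    its entry at x, y is c + 6 - q if they are adjacent and c otherwise, and it lies between -6 and
    6. *)
Lemma cospectral_hamming_common (x y : G) : x != y ->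
  if adj x y then (q <= #|nbhd x :&: nbhd y| + 12)%N && (#|nbhd x :&: nbhd y| <= q)%N
  else (#|nbhd x :&: nbhd y| <= 6)%N.
Proof.
move=> xy; pose i := enum_rank x; pose j := enum_rank y.
have nA := adjacency_mx_normal G.
set c := #|_|.
pose M := quadmx 1 (6 - q%:R) (9 - 3 * q%:R) (adjacency_mx G).
have psd : {in spectrum (adjacency_mx G),
    forall t, 0 <= 1 * t ^+ 2 + (6 - q%:R) * t + (9 - 3 * q%:R)}.
  (* The polynomial is [(t + 3) * (t + 3 - q)]. *)
  move=> _ /cospectral_hamming_spectrum[m m3 ->]; rewrite natrM.
  have -> : 1 * (q%:R * m%:R - 3) ^+ 2 + (6 - q%:R) * (q%:R * m%:R - 3) +
      (9 - 3 * q%:R) = q%:R ^+ 2 * (m%:R * (m%:R - 1)) :> algC by ring.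
  rewrite mulr_ge0// ?exprn_ge0// ?ler0n//.
  by case: m {m3} => [|m]; rewrite ?mul0r// mulr_ge0 ?subr_ge0 ?ler1n.
have ME z w : M (enum_rank z) (enum_rank w) = #|nbhd z :&: nbhd w|%:R +
    (6 - q%:R) * (adj z w)%:R + (9 - 3 * q%:R) *+ (z == w).
  by rewrite quadmx_entry adjacency_mx_sqr mxE !enum_rankK mul1r (inj_eq enum_rank_inj).
have diag z : M (enum_rank z) (enum_rank z) = 6.
  rewrite ME setIid adj_irr eqxx mulr0 addr0 mulr1n.
  have -> : #|nbhd z|%:R = 3 * q%:R - 3 :> algC.
    by rewrite -natrM -(cospectral_hamming_regular z) natrD addrK.
  ring.
have ji : M j i = M i j by rewrite !ME adj_sym setIC eq_sym.
have := quadmx_entry_bound nA psd (diag x) (diag y) erefl ji.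
rewrite -/M ME (negPf xy) mulr0n addr0 -/c; case: adj => /andP[].
  rewrite mulr1 => ge le; rewrite -!(ler_nat algC) natrD; apply/andP; split.
    by rewrite -subr_ge0; apply: etrans ge; congr (0 <= _); ring.
  by rewrite -subr_ge0; apply: etrans le; congr (0 <= _); ring.
by rewrite mulr0 addr0 subr_ge0 => _; rewrite (ler_nat algC _ 6).
Qed.

End HammingCospectral.

(** * Neighbourhoods of vertices *)

Local Close Scope ring_scope.
Local Open Scope nat_scope.

Lemma leq_card_bigcup (I T : finType) (F : I -> {set T}) :
  #|\bigcup_i F i| <= \sum_i #|F i|.
Proof.
elim/big_rec2: _ => [|i m B _ le]; first by rewrite cards0.
by apply: leq_trans (leq_card_setU _ _) _; rewrite leq_add2l.
Qed.

Section LocalGraph.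

Variables (q : nat) (G : sgraph).
Hypothesis q_large : 100 <= q.
Hypothesis degree : forall x : G, #|nbhd x| + 3 = 3 * q.
Hypothesis common_adj : forall x y : G, adj x y ->
  q <= #|nbhd x :&: nbhd y| + 12 /\ #|nbhd x :&: nbhd y| <= q.
Hypothesis common_nonadj : forall x y : G, x != y -> ~~ adj x y ->
  #|nbhd x :&: nbhd y| <= 6.

Section FixedVertex.

Variable x : G.

Let D (y : G) := nbhd x :&: nbhd y.
(** For a neighbour [y] of [x], this is its closed neighbourhood in the graph induced on
    [nbhd x]. *)
Let cl (y : G) := y |: D y.
Let nonadj (y z : G) := (y != z) && ~~ adj y z.

Let nonadjC y z : nonadj y z = nonadj z y.
Proof. by rewrite /nonadj eq_sym adj_sym. Qed.

Let card_cl y : #|cl y| = #|D y|.+1.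
Proof. by rewrite cardsU1 !inE adj_irr andbF. Qed.

Let D_bounds y : y \in nbhd x -> q <= #|D y| + 12 /\ #|D y| <= q.
Proof. by rewrite inE => /common_adj. Qed.

Let in_cl y z : z \in nbhd x -> (z \in cl y) = ~~ nonadj y z.
Proof.
by rewrite !inE /nonadj eq_sym negb_and !negbK => ->.
Qed.

Let card_D_nonadj y z : nonadj y z -> #|D y :&: D z| <= 6.
Proof.
move=> /andP[yz nyz]; apply: leq_trans (common_nonadj yz nyz).
by apply/subset_leq_card/subsetP => u; rewrite !inE => /andP[/andP[_ ->] /andP[_ ->]].
Qed.

Let card_cl_nonadj y z : nonadj y z -> #|cl y :&: cl z| <= 6.
Proof.
move=> yz; apply: leq_trans (card_D_nonadj yz); apply: subset_leq_card.
apply/subsetP => u; case/andP: (yz) => yNz nyz; rewrite !inE.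
case/andP => /orP[/eqP->|/andP[-> yu]]; last rewrite yu.
  by rewrite (negPf yNz) (adj_sym z) (negPf nyz) andbF.
case/orP => [/eqP zu|/andP[_ ->] //]; by rewrite zu (negPf nyz) in yu.
Qed.

(** The four sets [cl] have at least q - 11 elements each and meet pairwise in at most 6, so their
    union has at least 4(q - 11) - 36 > 3q - 3 elements. *)
Lemma local_coclique_size y1 y2 y3 y4 :
  all [in nbhd x] [:: y1; y2; y3; y4] -> ~~ pairwise nonadj [:: y1; y2; y3; y4].
Proof.
move=> /and5P[n1 n2 n3 n4 _]; apply/negP => /=.
move=> /and4P[/and4P[n12 n13 n14 _] /and3P[n23 n24 _] /andP[n34 _] _].
have [d1 _] := D_bounds n1; have [d2 _] := D_bounds n2.
have [d3 _] := D_bounds n3; have [d4 _] := D_bounds n4.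
move: (card_cl_nonadj n12) (card_cl_nonadj n13) (card_cl_nonadj n14).
move: (card_cl_nonadj n23) (card_cl_nonadj n24) (card_cl_nonadj n34).
have := cardsUI (cl y1) (cl y2); have := cardsUI (cl y1 :|: cl y2) (cl y3).
have := cardsUI (cl y1 :|: cl y2 :|: cl y3) (cl y4).
have := cardsUI (cl y1 :&: cl y3) (cl y2 :&: cl y3); rewrite -setIUl.
have := cardsUI (cl y1 :&: cl y4 :|: cl y2 :&: cl y4) (cl y3 :&: cl y4).
have := cardsUI (cl y1 :&: cl y4) (cl y2 :&: cl y4); rewrite -!setIUl.
have : #|cl y1 :|: cl y2 :|: cl y3 :|: cl y4| <= #|nbhd x|.
  apply: subset_leq_card; rewrite !subUset !sub1set n1 n2 n3 n4 /=.
  by rewrite !subsetIl.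
have := degree x; move: q_large d1 d2 d3 d4; rewrite !card_cl; lia.
Qed.

(** Greedy choice: two sets [cl] have at most 2q + 2 elements together, fewer than the 3q - 3
    neighbours of [x]. *)
Lemma local_coclique3 : exists y : 'I_3 -> G,
  (forall i, y i \in nbhd x) /\ (forall i j, i != j -> nonadj (y i) (y j)).
Proof.
have deg := degree x.
have extend (S : {set G}) : #|S| <= 2 * q + 2 -> exists2 y, y \in nbhd x & y \notin S.
  move=> S_small; apply/subsetPn; apply: contraTN isT => /subset_leq_card; lia.
have [y0 n0 _] : exists2 y, y \in nbhd x & y \notin set0.
  by apply: extend; rewrite cards0.
have [d0 D0] := D_bounds n0.
have [y1 n1] : exists2 y, y \in nbhd x & y \notin cl y0.
  by apply: extend; rewrite card_cl; lia.
rewrite in_cl// negbK => n01.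
have [d1 D1] := D_bounds n1.
have [y2 n2] : exists2 y, y \in nbhd x & y \notin cl y0 :|: cl y1.
  by apply: extend; have := cardsUI (cl y0) (cl y1); rewrite !card_cl; lia.
rewrite in_setU !in_cl// negb_or !negbK => /andP[n02 n12].
exists (tnth [tuple y0; y1; y2]); split.
  by case=> [[|[|[|]]]].
by case=> [[|[|[|]]]] // ? [[|[|[|]]]] //= ? _; rewrite /tnth /= // nonadjC.
Qed.

(** * Splitting a neighbourhood into three cliques *)

Section ThreeCliques.

Variable y : 'I_3 -> G.
Hypothesis y_nbhd : forall i, y i \in nbhd x.
Hypothesis y_nonadj : forall i j, i != j -> nonadj (y i) (y j).

(** The vertices attached to [y i] alone among the three; [rest] turns out to consist of those
    adjacent to at least two. *)
Let C i := cl (y i) :\: \bigcup_(j | j != i) D (y j).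
Let rest := nbhd x :\: \bigcup_i C i.

Let CP i v :
  reflect (v \in cl (y i) /\ forall j, j != i -> v \notin D (y j)) (v \in C i).
Proof.
rewrite in_setD andbC; apply: (iffP andP) => -[vi vN]; split=> //.
  move=> j ji; apply: contra vN => vj; apply/bigcupP; exists j => //.
by apply/bigcupP => -[j ji]; apply/negP/vN.
Qed.

Let ord3_other (i : 'I_3) : exists j k, [/\ i != j, i != k, j != k &
  forall l, [|| l == i, l == j | l == k]].
Proof.
pose o0 : 'I_3 := inord 0; pose o1 : 'I_3 := inord 1; pose o2 : 'I_3 := inord 2.
by case: i => [[|[|[|//]]] ?]; [exists o1, o2|exists o0, o2|exists o0, o1];
  split; rewrite -?val_eqE /= ?inordK// => -[[|[|[|]]]] // ?;
  rewrite -!val_eqE /= ?inordK.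
Qed.

Let cl_nbhd v : v \in nbhd x -> cl v \subset nbhd x.
Proof. by move=> vx; rewrite subUset sub1set vx subsetIl. Qed.

Let C_nbhd i : C i \subset nbhd x.
Proof. by apply: subset_trans (subsetDl _ _) (cl_nbhd _). Qed.

Let C_neq i j v : v \in C i -> i != j -> nonadj v (y j).
Proof.
move=> /[dup] /(subsetP (C_nbhd i)) vx /CP[vi vN] ij; rewrite nonadjC.
rewrite -[nonadj _ _]negbK -in_cl// in_setU1 negb_or (vN j) 1?eq_sym// andbT.
by apply: contraTneq vi => <-; rewrite in_cl// negbK y_nonadj.
Qed.

(** Two nonadjacent elements would form a coclique of size four with the other two [y j]. *)
Let C_clique i : {in C i &, forall u v, ~~ nonadj u v}.
Proof.
move=> u v uC vC; apply/negP => uv.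
have [j [k [ij ik jk _]]] := ord3_other i.
apply: (negP (@local_coclique_size u v (y j) (y k) _)).
  by rewrite /= !y_nbhd !(subsetP (C_nbhd i)).
rewrite /pairwise /= uv y_nonadj//.
by rewrite !(C_neq uC)// !(C_neq vC).
Qed.

(** Of the at least q - 11 elements of [cl (y i)], each of the other two [y j] removes at most 6. *)
Let card_C i : q <= #|C i| + 23.
Proof.
have [j [k [ij ik jk ijk]]] := ord3_other i.
have [dge dle] := D_bounds (y_nbhd i).
have := card_cl_nonadj (y_nonadj ij); have := card_cl_nonadj (y_nonadj ik).
have : #|cl (y i)| <= #|C i| + #|cl (y i) :&: cl (y j)| + #|cl (y i) :&: cl (y k)|.
  apply: leq_trans (leq_add (leq_card_setU _ _) (leqnn _)).
  apply: leq_trans (leq_card_setU _ _); apply: subset_leq_card.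
  apply/subsetP => v vi; rewrite !in_setU !in_setI vi /=.
  case: CP => //= vN; apply: contra_notT vN => /norP[vj vk]; split=> // l li.
  have := ijk l; rewrite (negPf li) /= => /orP[]/eqP->.
    by apply: contra vj => vD; rewrite in_setU1 vD orbT.
  by apply: contra vk => vD; rewrite in_setU1 vD orbT.
rewrite card_cl; lia.
Qed.

(** Since no coclique has size four, a neighbour of [x] lies in some [cl (y i)]; outside the cliques
    it is adjacent to two of the [y i]. Each of the three pairs, enumerated as [i], [ordS i],
    accounts for at most 6 vertices. *)
Let card_rest : #|rest| <= 18.
Proof.
have succ_neq (i : 'I_3) : i != ordS i by rewrite -val_eqE; case: i => [[|[|[|]]]].
have succP (i j : 'I_3) : i != j -> j = ordS i \/ i = ordS j.
  by case: i j => [[|[|[|]]]] // ? [[|[|[|]]]] //= ? _;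
    [left|right|right|left|left|right]; apply: val_inj.
apply: leq_trans (_ : \sum_(i < 3) 6 <= 18); last by rewrite sum_nat_const card_ord.
pose P (i : 'I_3) := D (y i) :&: D (y (ordS i)).
apply: leq_trans (_ : \sum_i #|P i| <= _).
  apply: leq_trans (leq_card_bigcup _); apply/subset_leq_card/subsetP => v.
  rewrite in_setD => /andP[vNC vx].
  have [i vi] : exists i, v \in cl (y i).
    apply/existsP; apply: contraT; rewrite negb_exists => /forallP far.
    have [j [k [ij ik jk _]]] := ord3_other ord0.
    have far' i : nonadj v (y i) by rewrite nonadjC -[nonadj _ _]negbK -in_cl// far.
    have := @local_coclique_size v (y ord0) (y j) (y k).
    by rewrite /pairwise /= vx !y_nbhd !far' !y_nonadj// => /(_ isT).
  have [j ji vj] : exists2 j, j != i & v \in D (y j).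
    have : v \notin C i by apply: contra vNC => vC; apply/bigcupP; exists i.
    by rewrite in_setD vi andbT negbK => /bigcupP[j]; exists j.
  have {}vi : v \in D (y i).
    move: vi; rewrite in_setU1 => /orP[/eqP vE|//].
    have := y_nonadj ji; rewrite -[nonadj _ _]negbK -in_cl// in_setU1.
    by rewrite -vE vj orbT.
  by have [E|E] := succP _ _ ji; apply/bigcupP; [exists j|exists i];
    rewrite // in_setI -E ?vi ?vj.
by apply: leq_sum => i _; apply: card_D_nonadj; apply: y_nonadj.
Qed.

Let cover (A : {set G}) : A \subset nbhd x -> #|A| <= \sum_i #|A :&: C i| + 18.
Proof.
move=> Ax; apply: leq_trans (leq_add (leqnn _) card_rest).
apply: leq_trans (leq_add (leq_card_bigcup (fun i => A :&: C i)) (leqnn _)).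
apply: leq_trans (leq_card_setU _ _); apply/subset_leq_card/subsetP => v vA.
rewrite in_setU in_setD (subsetP Ax) ?andbT//.
case: (boolP (v \in \bigcup_i C i)) => [/bigcupP[i _ vi]|]; last by rewrite orbT.
by rewrite orbF; apply/bigcupP; exists i; rewrite // in_setI vA.
Qed.

(** If [w] is not adjacent to some [v] in the clique [C i], its neighbours in [C i] are common
    neighbours of [v] and [w]. *)
Let few_or_all i w : w \in nbhd x -> (#|D w :&: C i| <= 6) || (C i \subset cl w).
Proof.
move=> wx; apply: contraTT isT; rewrite negb_or -ltnNge.
move=> /andP[many /subsetPn[v vC vw]].
have vx := subsetP (C_nbhd i) v vC; rewrite in_cl// negbK in vw.
suff : #|D w :&: C i| <= 6 by rewrite leqNgt many.
apply: leq_trans (card_D_nonadj vw); apply/subset_leq_card/subsetP => u.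
rewrite in_setI => /andP[uw uC]; rewrite in_setI uw /=.
have := C_clique vC uC; rewrite -in_cl ?(subsetP (C_nbhd i))// in_setU1.
case/orP => [/eqP uv|//]; move: uw; rewrite uv => vDw.
by move: vw; rewrite -[nonadj _ _]negbK -in_cl// in_setU1 vDw orbT.
Qed.

(** Otherwise [D w] has at most 3 * 6 + 18 elements, fewer than q - 12. *)
Let exists_class w : w \in nbhd x -> exists i, C i \subset cl w.
Proof.
move=> wx; apply/existsP; apply: contraTT isT; rewrite negb_exists => /forallP none.
have [dge _] := D_bounds wx.
have : \sum_i #|D w :&: C i| <= \sum_(i < 3) 6.
  by apply: leq_sum => i _; have := few_or_all i wx; rewrite (negPf (none i)) orbF.
have := cover (subsetIl _ _ : D w \subset _).
rewrite sum_nat_const card_ord; lia.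
Qed.

(** Two disjoint cliques have at least 2q - 46 elements, too many for [cl w] with at most q + 1. *)
Let class_inj w i j : w \in nbhd x -> C i \subset cl w -> C j \subset cl w -> i = j.
Proof.
move=> wx iw jw; apply/eqP; apply: contraTT isT => ij.
have [_ dle] := D_bounds wx.
have dis : [disjoint C i & C j].
  apply/pred0P => v /=; apply/negP => /andP[vi vj].
  have := C_neq vi ij; rewrite nonadjC -[nonadj _ _]negbK.
  rewrite -in_cl ?(subsetP (C_nbhd i))//.
  by case/CP: vj => ->.
have : #|C i :|: C j| <= #|cl w| by rewrite subset_leq_card// subUset iw.
have := card_C i; have := card_C j.
have := cardsUI (C i) (C j); rewrite (disjoint_setI0 dis) cards0 card_cl; lia.
Qed.

Lemma three_cliques_classes : exists c : G -> 'I_3,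
  (forall i, exists2 u, u \in nbhd x & c u = i) /\
  {in nbhd x &, forall u v,
    (c u == c v) = (40 <= #|nbhd x :&: nbhd u :&: nbhd v|)}.
Proof.
pose c w := odflt ord0 [pick i | C i \subset cl w].
have cP w : w \in nbhd x -> C (c w) \subset cl w.
  move=> wx; rewrite /c; case: pickP => //= none.
  by have [i] := exists_class wx; rewrite none.
exists c; split=> [i|u v ux vx].
  exists (y i) => //; apply: (class_inj (y_nbhd i)) => //; first exact: cP.
  exact: subsetDl.
apply/eqP/idP => [cuv|].
  (* In the same class, [u] and [v] have with [x] at least q - 25 common neighbours: the clique
     without [u] and [v]. *)
  have : #|C (c u)| <= #|[set u; v] :|: nbhd x :&: nbhd u :&: nbhd v|.
    apply/subset_leq_card/subsetP => w wC.
    have := subsetP (cP u ux) w wC.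
    have : w \in cl v by apply: (subsetP (cP v vx)); rewrite -cuv.
    rewrite !inE; case: eqP => //= _; case: eqP => //= _.
    by rewrite ?orbT// => /andP[-> ->] /andP[_ ->].
  have [le _] := leq_card_setU [set u; v] (nbhd x :&: nbhd u :&: nbhd v).
  move: le; have := card_C (c u); have := cards2 u v; case: eqP => /= _; lia.
apply: contraTeq => cuv; rewrite -ltnNge ltnS.
set A := _ :&: _ :&: _; have Ax : A \subset nbhd x by rewrite /A -setIA subsetIl.
(* In different classes, at least one of [u], [v] is not of class [l] and has at most 6 neighbours
   in [C l]. This leaves at most 3 * 6 + 18 = 36 < 40 vertices. *)
have few l : #|A :&: C l| <= 6.
  have Au : A \subset D u by rewrite subsetIl.
  have Av : A \subset D v by rewrite /A setIAC subsetIl.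
  have [uE|ul] := eqVneq (c u) l.
    have := few_or_all l vx; case/orP; last first.
      by move=> /(class_inj vx (cP v vx)) vl; rewrite uE vl eqxx in cuv.
    by apply: leq_trans; rewrite subset_leq_card// setSI.
  have := few_or_all l ux; case/orP; last first.
    by move=> /(class_inj ux (cP u ux)) El; rewrite El eqxx in ul.
  by apply: leq_trans; rewrite subset_leq_card// setSI.
apply: leq_trans (cover Ax) _.
have : \sum_i #|A :&: C i| <= \sum_(i < 3) 6 by apply: leq_sum.
rewrite sum_nat_const card_ord; lia.
Qed.

End ThreeCliques.

Lemma local_classes : exists c : G -> 'I_3,
  (forall i, exists2 y, y \in nbhd x & c y = i) /\
  {in nbhd x &, forall y z,
    (c y == c z) = (40 <= #|nbhd x :&: nbhd y :&: nbhd z|)}.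
Proof.
have [y [y_nbhd y_nonadj]] := local_coclique3.
exact: three_cliques_classes y_nbhd y_nonadj.
Qed.

End FixedVertex.
End LocalGraph.

(** * The hypergraph of lines *)

Section LineHypergraph.

Variables (G : sgraph) (b : nat).
Hypothesis common_adj : forall x y : G, adj x y -> b <= #|nbhd x :&: nbhd y|.
Hypothesis common_nonadj : forall x y : G, x != y -> ~~ adj x y ->
  #|nbhd x :&: nbhd y| < b.
Hypothesis classes : forall x : G, exists c : G -> 'I_3,
  (forall i, exists2 y, y \in nbhd x & c y = i) /\
  {in nbhd x &, forall y z,
    (c y == c z) = (b <= #|nbhd x :&: nbhd y :&: nbhd z|)}.

(** All of [G] is tested, so for an edge the line contains its two ends. *)
Definition graph_line (x y : G) : {set G} :=
  [set z | b <= #|nbhd x :&: nbhd y :&: nbhd z|].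

Definition lines_at (x : G) : {set {set G}} := [set graph_line x y | y in nbhd x].

Lemma graph_lineC x y : graph_line x y = graph_line y x.
Proof. by rewrite /graph_line (setIC (nbhd x)). Qed.

Lemma graph_line_id x y : adj x y -> x \in graph_line x y.
Proof. by rewrite inE setIAC setIid; apply: common_adj. Qed.

Lemma graph_line_adj x y z : z \in graph_line x y -> x != z -> adj x z.
Proof.
rewrite inE setIAC => xz xNz; apply: contraTT xz => nxz.
rewrite -ltnNge (leq_ltn_trans _ (common_nonadj xNz nxz))//.
by rewrite subset_leq_card// subsetIl.
Qed.

(** Around [x], lying on a common line means having the same class, which is an equivalence
    relation. *)
Lemma eq_graph_line x y z : adj x y -> adj x z ->
  (graph_line x y == graph_line x z) = (z \in graph_line x y).
Proof.
move=> xy xz; have [c [_ cE]] := classes x.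
apply/eqP/idP => [->|zy].
  by rewrite graph_lineC graph_line_id// adj_sym.
apply/setP => w; have [<-|xNw] := eqVneq x w; first by rewrite !graph_line_id.
have [xw|nxw] := boolP (adj x w); last first.
  by apply/idP/idP => /graph_line_adj/(_ xNw); rewrite (negPf nxw).
by move: zy; rewrite !inE -!cE ?inE// => /eqP ->.
Qed.

(** The two defining points are exchanged one at a time, from [x], [y] to [u], [x] to [u], [v],
    using the classes around [x] and then around [u]. *)
Lemma graph_line_two_points x y u v : adj x y ->
    u \in graph_line x y -> v \in graph_line x y -> u != v ->
  adj u v /\ graph_line x y = graph_line u v.
Proof.
move=> xy uL vL uNv; have [xu|xNu] := eqVneq x u.
  subst u; have xv := graph_line_adj vL uNv.
  by split=> //; apply/eqP; rewrite eq_graph_line.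
have xu := graph_line_adj uL xNu; have ux : adj u x by rewrite adj_sym.
have LE : graph_line x y = graph_line u x.
  by rewrite (graph_lineC u); apply/eqP; rewrite eq_graph_line.
rewrite LE in vL *; have uv := graph_line_adj vL uNv.
by split=> //; apply/eqP; rewrite eq_graph_line.
Qed.

Lemma mem_lines_at x y : adj x y -> graph_line x y \in lines_at x.
Proof. by move=> xy; apply: imset_f; rewrite inE. Qed.

Lemma common_line u v l : l \in lines_at u -> l \in lines_at v -> u != v ->
  adj u v /\ l = graph_line u v.
Proof.
case/imsetP => y uy ->; case/imsetP => z vz E uNv; rewrite !inE in uy vz.
by apply: graph_line_two_points; rewrite ?graph_line_id ?E ?graph_line_id.
Qed.

Lemma card_lines_at x : #|lines_at x| = 3.
Proof.
have [c [/fin_all_exists2[r rx cr] cE]] := classes x.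
have rE i y : y \in nbhd x -> (graph_line x (r i) == graph_line x y) = (i == c y).
  move=> xy; have := xy; have := rx i; rewrite !inE => xr xy'.
  by rewrite eq_graph_line// inE -cE ?cr.
have -> : lines_at x = [set graph_line x (r i) | i : 'I_3].
  apply/setP => l; apply/imsetP/imsetP => -[y xy ->]; last by exists (r y).
  by exists (c y) => //; apply/esym/eqP; rewrite rE.
by rewrite card_imset ?card_ord// => i j /eqP; rewrite rE// cr => /eqP.
Qed.

(** Distinct vertices share at most one line, but there are three through each. Hence distinct
    vertices give distinct edges. *)
Lemma lines_at_inj : injective lines_at.
Proof.
move=> u v uv; apply/eqP; apply: contraT => uNv.
have : lines_at u \subset [set graph_line u v].
  apply/subsetP => l lu; rewrite inE.
  by have [|_ ->] := common_line lu _ uNv; rewrite -?uv.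
by move/subset_leq_card; rewrite cards1 card_lines_at.
Qed.

Fact line_hypergraph_neq0 : set0 \notin [set lines_at x | x : G].
Proof.
by apply/imsetP => -[x _ E]; have := card_lines_at x; rewrite -E cards0.
Qed.

(** Every subset of [G] is a vertex here; those that are not lines lie in no edge. *)
Definition line_hypergraph := Hypergraph line_hypergraph_neq0.

Lemma line_hypergraph_linear : linear_hypergraph line_hypergraph.
Proof.
move=> l m lNm _ _ /imsetP[u _ ->] /imsetP[v _ ->] lu mu lv mv.
have [->//|uNv] := eqVneq u v.
have [_ lE] := common_line lu lv uNv; have [_ mE] := common_line mu mv uNv.
by rewrite lE mE eqxx in lNm.
Qed.

Lemma line_hypergraph_uniform : uniform_hypergraph 3 line_hypergraph.
Proof. by move=> _ /imsetP[x _ ->]; apply: card_lines_at. Qed.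

Lemma iso_line_hypergraph : graph_iso G (intersection_graph line_hypergraph).
Proof.
have edge (x : G) : lines_at x \in hedges line_hypergraph by apply: imset_f.
pose f (x : G) : intersection_graph line_hypergraph := exist _ (lines_at x) (edge x).
have f_inj : injective f by move=> u v /(congr1 val)/lines_at_inj.
exists f => [|u v].
  by apply: inj_card_bij f_inj _; rewrite card_sig; apply: leq_imset_card.
rewrite /= /inter_adj (inj_eq f_inj) /=; apply/andP/idP => [[uNv]|uv].
  by case/set0Pn => l; rewrite in_setI => /andP[lu lv]; case: (common_line lu lv uNv).
split; first by apply: contraTneq uv => ->; rewrite adj_irr.
apply/set0Pn; exists (graph_line u v); rewrite in_setI mem_lines_at//=.
by rewrite graph_lineC mem_lines_at// adj_sym.
Qed.

End LineHypergraph.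

Theorem theorem1p6 :
  exists q' : nat, (0 < q')%N /\
    forall q : nat, (q' <= q)%N ->
    forall G : sgraph, cospectral G (hamming 3 'I_q) ->
    exists H : hypergraph,
      [/\ linear_hypergraph H, uniform_hypergraph 3 H &
          graph_iso G (intersection_graph H)].
Proof.
(* A round number: the strongest demand is 4q - 80 > 3q - 3, from [local_coclique_size]. *)
exists 100; split=> // q q_large G cosp.
have q_gt0 : 0 < q by apply: leq_trans q_large.
have degree := cospectral_hamming_regular cosp q_gt0.
have common_adj (x y : G) : adj x y ->
    q <= #|nbhd x :&: nbhd y| + 12 /\ #|nbhd x :&: nbhd y| <= q.
  move=> xy; have xNy : x != y by apply: contraTneq xy => ->; rewrite adj_irr.
  by have := cospectral_hamming_common cosp q_gt0 xNy; rewrite xy => /andP.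
have common_nonadj (x y : G) : x != y -> ~~ adj x y -> #|nbhd x :&: nbhd y| <= 6.
  move=> xNy nxy; have := cospectral_hamming_common cosp q_gt0 xNy.
  by rewrite (negPf nxy).
have classes := local_classes q_large degree common_adj common_nonadj.
have common_adj40 (x y : G) : adj x y -> 40 <= #|nbhd x :&: nbhd y|.
  by case/common_adj; lia.
have common_nonadj40 (x y : G) : x != y -> ~~ adj x y -> #|nbhd x :&: nbhd y| < 40.
  by move=> xNy nxy; apply: leq_ltn_trans (common_nonadj x y xNy nxy) _.
exists (line_hypergraph common_adj40 common_nonadj40 classes); split.
- exact: line_hypergraph_linear.
- exact: line_hypergraph_uniform.
- exact: iso_line_hypergraph.
Qed.
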